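(* Let $(X,r)$ be a square-free non-degenerate symmetric set of arbitrary cardinality (with $S(X,r)$ embedded in $G=G(X,r)$) which is not the trivial solution. (1) The following are equivalent: (a) $\mathrm{mpl}(X,r)=2$; (b) $\mathrm{mpl}(G,r_G)=2$; (c) $G$ acts upon itself as automorphisms, equivalently $\mathcal{L}_{{}^ba}=\mathcal{L}_a$ for all $a,b\in G$; (d) $(G,r_G)$ satisfies lri; (e) the left brace $(G,+,\cdot)$ satisfies Raut. (2) More generally, for $m\ge2$: $\mathrm{mpl}(X,r)=m$ if and only if the derived symmetric group $(G_{m-2},r_{G_{m-2}})$ is nonabelian and satisfies lri.
   Context: A symmetric set is $(X,r)$, $r(x,y)=({}^xy,x^y)$ a non-degenerate (all $y\mapsto{}^xy$, $y\mapsto y^x$ bijective), involutive bijection of $X\times X$ with $r^{12}r^{23}r^{12}=r^{23}r^{12}r^{23}$ on $X^3$; square-free if $r(x,x)=(x,x)$; trivial if $r(x,y)=(y,x)$. $S(X,r)$, $G(X,r)$: monoid, group generated by $X$ with relations $xy=zt$ whenever $r(x,y)=(z,t)\ne(x,y)$. A symmetric group is $(G,\sigma)$, $\sigma(u,v)=({}^uv,u^v)$ involutive with ${}^a1=1,{}^1u=u,1^u=1,a^1=a$, ${}^{ab}u={}^a({}^bu)$, $a^{uv}=(a^u)^v$, ${}^a(uv)=({}^au)({}^{a^u}v)$, $(ab)^u=(a^{{}^bu})(b^u)$, $uv=({}^uv)(u^v)$; $(G,r_G)$ is $G(X,r)$ with the unique such braiding extending $r$; its left brace has $a+b:=a({}^{a^{-1}}b)$.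 $\mathcal{L}_a(b)={}^ab$. ''Acts as automorphisms'': ${}^a(bc)=({}^ab)({}^ac)$. lri: $({}^ab)^a=b={}^a(b^a)$ for all $a,b$. Raut: $(a+b)^c=a^c+b^c$. Retraction $\mathrm{Ret}(X,r)$: $x\sim y$ iff ${}^xz={}^yz\ \forall z$, $r_{[X]}([x],[y])=([{}^xy],[x^y])$; $\mathrm{Ret}^j$ iterates; $\mathrm{mpl}=m$ iff $m$ minimal with $\mathrm{Ret}^m$ one element. Derived symmetric groups: $(G_j,r_{G_j})=$ the associated symmetric group of $\mathrm{Ret}^j(X,r)$, $j\ge0$. *)

(* Defs.v *)
From Stdlib Require Import List Relations Arith.
Import ListNotations.
Set Implicit Arguments.

Record group := Group {
  gcar :> Type;
  gmul : gcar -> gcar -> gcar;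
  gone : gcar;
  ginv : gcar -> gcar;
  gmulA : forall a b c, gmul a (gmul b c) = gmul (gmul a b) c;
  gmul1l : forall a, gmul gone a = a;
  gmul1r : forall a, gmul a gone = a;
  gmulVl : forall a, gmul (ginv a) a = gone;
  gmulVr : forall a, gmul a (ginv a) = gone }.

Definition is_hom (G H : group) (f : G -> H) : Prop :=
  forall a b, f (gmul G a b) = gmul H (f a) (f b).

(** [G] together with [i : X -> G] is the group presented by generators [X]
    subject to the relations [Rel] (given as a condition on maps into
    arbitrary groups): universal property of the presentation. *)
Definition presented (X : Type) (G : group) (i : X -> G)
  (Rel : forall H : group, (X -> H) -> Prop) : Prop :=
  Rel G i /\
  forall (H : group) (f : X -> H), Rel H f ->
    (exists phi : G -> H, @is_hom G H phi /\ forall x, phi (i x) = f x) /\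
    (forall phi1 phi2 : G -> H, @is_hom G H phi1 -> @is_hom G H phi2 ->
       (forall x, phi1 (i x) = f x) -> (forall x, phi2 (i x) = f x) ->
       forall g, phi1 g = phi2 g).

(** * Symmetric sets: r(x,y) = (L x y, R x y) = (^x y, x^y) *)
Definition bijective (T : Type) (f : T -> T) : Prop :=
  exists g : T -> T, (forall a, g (f a) = a) /\ (forall b, f (g b) = b).

Section SymSet.
Variables (X : Type) (L R : X -> X -> X).

Definition rmap (p : X * X) : X * X := (L (fst p) (snd p), R (fst p) (snd p)).
Definition r12 (t : X * X * X) : X * X * X :=
  let '(a, b, c) := t in (L a b, R a b, c).
Definition r23 (t : X * X * X) : X * X * X :=
  let '(a, b, c) := t in (a, L b c, R b c).

Definition nondegenerate : Prop :=
  forall x, bijective (L x) /\ bijective (fun y => R y x).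
Definition involutive_sol : Prop := forall p, rmap (rmap p) = p.
Definition braided : Prop :=
  forall t, r12 (r23 (r12 t)) = r23 (r12 (r23 t)).
Definition symmetric_set : Prop :=
  nondegenerate /\ involutive_sol /\ braided.
Definition square_free : Prop := forall x, rmap (x, x) = (x, x).
Definition trivial_sol : Prop := forall x y, rmap (x, y) = (y, x).

Definition GXr_rel (H : group) (f : X -> H) : Prop :=
  forall x y, rmap (x, y) <> (x, y) ->
    gmul H (f x) (f y) = gmul H (f (L x y)) (f (R x y)).

(** the monoid S(X,r): words modulo the congruence generated by the relations *)
Definition Sstep (w1 w2 : list X) : Prop :=
  exists u v x y, w1 = u ++ x :: y :: v /\
    w2 = u ++ L x y :: R x y :: v /\ rmap (x, y) <> (x, y).
Definition Seq : list X -> list X -> Prop := clos_refl_sym_trans (list X) Sstep.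

Definition wprod (G : group) (i : X -> G) (w : list X) : G :=
  fold_right (fun x acc => gmul G (i x) acc) (gone G) w.

Definition S_embeds (G : group) (i : X -> G) : Prop :=
  forall w1 w2, @wprod G i w1 = @wprod G i w2 -> Seq w1 w2.
End SymSet.

(** [retrel L j x y] : x and y have the same image in Ret^j.
    Ret^(j+1) = Ret(Ret^j): [x]_j ~ [y]_j iff ^[x][z] = ^[y][z] for all z. *)
Fixpoint retrel (T : Type) (L : T -> T -> T) (j : nat) : T -> T -> Prop :=
  match j with
  | 0 => fun x y => x = y
  | S j' => fun x y => forall z, retrel L j' (L x z) (L y z)
  end.

Definition mpl_eq (T : Type) (L : T -> T -> T) (m : nat) : Prop :=
  (inhabited T /\ forall x y, retrel L m x y) /\
  (forall k, k < m -> ~ (inhabited T /\ forall x y, retrel L k x y)).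

(** defining relations of the associated group of Ret^j(X,r), written with
    generators X: x = y when [x]_j = [y]_j, and xy = zt when
    r_[X]([x],[y]) = ([z],[t]) <> ([x],[y]). *)
Definition Gj_rel (X : Type) (L R : X -> X -> X) (j : nat)
  (H : group) (f : X -> H) : Prop :=
  (forall x y, retrel L j x y -> f x = f y) /\
  (forall x y, ~ (retrel L j (L x y) x /\ retrel L j (R x y) y) ->
     gmul H (f x) (f y) = gmul H (f (L x y)) (f (R x y))).

(** * Symmetric groups (G, sigma), sigma(u,v) = (la u v, ra u v) = (^u v, u^v) *)
Section SymGroup.
Variables (G : group) (la ra : G -> G -> G).
Local Notation "a * b" := (gmul G a b).
Local Notation "1" := (gone G).

Definition symmetric_group : Prop :=
  (forall u v, la (la u v) (ra u v) = u /\ ra (la u v) (ra u v) = v) /\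
  (forall a, la a 1 = 1) /\ (forall u, la 1 u = u) /\
  (forall u, ra 1 u = 1) /\ (forall a, ra a 1 = a) /\
  (forall a b u, la (a * b) u = la a (la b u)) /\
  (forall a u v, ra a (u * v) = ra (ra a u) v) /\
  (forall a u v, la a (u * v) = la a u * la (ra a u) v) /\
  (forall a b u, ra (a * b) u = ra a (la b u) * ra b u) /\
  (forall u v, u * v = la u v * ra u v).

Definition acts_as_aut : Prop := forall a b c, la a (b * c) = la a b * la a c.
Definition lri : Prop := forall a b, ra (la a b) a = b /\ la a (ra b a) = b.
Definition badd (a b : G) : G := a * la (ginv G a) b.
Definition raut : Prop := forall a b c, ra (badd a b) c = badd (ra a c) (ra b c).
Definition nonabelian : Prop := exists a b, a * b <> b * a.
End SymGroup.

Arguments presented {X G} i Rel.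
Arguments S_embeds {X} L R {G} i.
Arguments GXr_rel {X} L R H f.
Arguments Gj_rel {X} L R j H f.
Arguments symmetric_group {G} la ra.
Arguments acts_as_aut {G} la.
Arguments lri {G} la ra.
Arguments raut {G} la ra.
Arguments badd {G} la a b.
Arguments mpl_eq {T} L m.
Arguments retrel {T} L j _ _.

(* Main.v *)
Require Import Defs.
From Stdlib Require Import List Relations Arith.
From Stdlib Require Import ZArith Lia Classical ClassicalEpsilon.
From Stdlib Require Import FunctionalExtensionality PropExtensionality ProofIrrelevance.

(** A square-free solution satisfies [x^y = L_y^-1 x], and [mpl X <= 2] means
    [L_{^x y} = L_y] on [X].  Sending [x] to (delta_x, L_x) defines a homomorphism
    from [G] to the semidirect product of Z^X with Sym(X): this yields an additive
    map [G -> Z^X] (so [X] embeds in [G]) and an action of [G] on [X] inducing [la]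
    on the generators.  Since [X] additively generates [G] and each [la a] is
    additive, [L_{^x y} = L_y] spreads from [X] to [G], which is equivalent to
    acting by automorphisms and implies lri.  Conversely lri gives
    [L_b^-1 a = L_{^a b}^-1 a] in [G]; comparing coefficients in Z^X for
    [a = x + x + z] isolates [x] and gives back [L_{^x y} = L_y] on [X].  Under Raut
    the maps [a |-> a^c] and [la c^-1] are additive and agree on [X], so lri holds.
    For [m > 2] the same is applied to the square-free solution Ret^(m-2). *)

(** * Elementary group theory and subgroups *)

Section GroupFacts.
Variable G : group.
Local Notation "a * b" := (gmul G a b).
Local Notation "1" := (gone G).
Local Notation "a ^-1" := (ginv G a) (at level 1, format "a ^-1").

Lemma gmulKl (a b : G) : a^-1 * (a * b) = b.
Proof. now rewrite gmulA, gmulVl, gmul1l. Qed.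

Lemma gmulVKl (a b : G) : a * (a^-1 * b) = b.
Proof. now rewrite gmulA, gmulVr, gmul1l. Qed.

Lemma gmul_cancel_l (a b c : G) : a * b = a * c -> b = c.
Proof. intros e. rewrite <- (gmulKl a b), e. apply gmulKl. Qed.

Lemma ginv_unique (a b : G) : a * b = 1 -> b = a^-1.
Proof. intros e. apply (gmul_cancel_l a). now rewrite gmulVr. Qed.

Lemma ginvK (a : G) : (a^-1)^-1 = a.
Proof. symmetry. apply ginv_unique, gmulVl. Qed.

Lemma ginvM (a b : G) : (a * b)^-1 = b^-1 * a^-1.
Proof.
  symmetry. apply ginv_unique.
  now rewrite <- gmulA, (gmulA _ b), gmulVr, gmul1l, gmulVr.
Qed.

Lemma hom_one (H : group) (f : H -> G) : is_hom H G f -> f (gone H) = 1.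
Proof.
  intros hf. apply (gmul_cancel_l (f (gone H))).
  now rewrite <- hf, !gmul1r.
Qed.

Variable P : G -> Prop.
Hypothesis (P1 : P 1) (PM : forall a b, P a -> P b -> P (a * b))
  (PV : forall a, P a -> P a^-1).

Definition subgroup : group.
Proof.
  refine (@Group {g : G | P g}
    (fun a b => exist P (proj1_sig a * proj1_sig b)
                  (PM _ _ (proj2_sig a) (proj2_sig b)))
    (exist P 1 P1) (fun a => exist P (proj1_sig a)^-1 (PV _ (proj2_sig a)))
    _ _ _ _ _); intros; apply eq_sig_hprop; intros; try apply proof_irrelevance; simpl.
  - apply gmulA.
  - apply gmul1l.
  - apply gmul1r.
  - apply gmulVl.
  - apply gmulVr.
Defined.
End GroupFacts.

Arguments gmul_cancel_l {G} a b c.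
Arguments ginv_unique {G} a b.
Arguments hom_one {G H} f.

(** * Square-free solutions in equational form *)

(** Equations pass to quotients by a congruence, while bijectivity does not do so by itself. Here it
    is encoded by the explicit inverse [fun y => R y x] of [L x]. *)
Record sf_solution (X : Type) (L R : X -> X -> X) : Prop := {
  sf_LR : forall x y, L x (R y x) = y;
  sf_RL : forall x y, R (L x y) x = y;
  sf_diag : forall x, L x x = x;
  sf_inv : forall x y, L (L x y) (R x y) = x;
  sf_braid : forall x y z, L x (L y z) = L (L x y) (L (R x y) z) }.

(* With [x . y := L_x^-1 y] the braid relation reads
   (x . y) . (x . z) = (y . x) . (y . z); taking z = y and y . y = y gives the
   cyclic condition (x . y) . y = x . y, which is [R y x = L_x^-1 y]. *)
Lemma sf_solution_of_symmetric (X : Type) (L R : X -> X -> X) :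
  symmetric_set L R -> square_free L R -> sf_solution X L R.
Proof.
  intros [Hnd [Hinv Hbr]] Hsf.
  assert (Linj : forall x y z, L x y = L x z -> y = z).
  { intros x y z e. destruct (Hnd x) as [[g [Hg _]] _].
    now rewrite <- (Hg y), e. }
  assert (diag : forall x, L x x = x).
  { intros x. specialize (Hsf x). unfold rmap in Hsf. simpl in Hsf. congruence. }
  assert (inv : forall x y, L (L x y) (R x y) = x).
  { intros x y. specialize (Hinv (x, y)). unfold rmap in Hinv. simpl in Hinv. congruence. }
  assert (br : forall x y z, L x (L y z) = L (L x y) (L (R x y) z)).
  { intros x y z. specialize (Hbr (x, y, z)). simpl in Hbr. congruence. }
  assert (RL : forall x y, R (L x y) x = y).
  { intros x y. set (u := L x y). symmetry.
    apply (Linj (R u x)). rewrite diag. apply (Linj (L u x)).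
    rewrite <- br, inv. fold u. apply diag. }
  split; auto.
  intros x y. destruct (Hnd x) as [[g [_ Hg]] _].
  rewrite <- (Hg y) at 1. now rewrite RL.
Qed.

(** * Iterated retractions and the multipermutation level *)

Section Retraction.
Variables (X : Type) (L : X -> X -> X).

Lemma retrel_all_S j : (forall x y, retrel L j x y) -> forall x y, retrel L (S j) x y.
Proof. simpl. auto. Qed.

Lemma retrel_all_le j k : j <= k ->
  (forall x y, retrel L j x y) -> forall x y, retrel L k x y.
Proof. induction 1; auto using retrel_all_S. Qed.

(** Once a retraction is a single point it stays one, so minimality has to be checked only one level
    below. *)
Lemma mpl_eq_S m : inhabited X ->
  (mpl_eq L (S m) <->
   (forall x y, retrel L (S m) x y) /\ ~ (forall x y, retrel L m x y)).
Proof.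
  intros HI. split.
  - intros [[_ H1] H2]. split; [exact H1|]. intros H3. apply (H2 m); auto.
  - intros [H1 H2]. split; [auto|]. intros k Hk [_ H3]. apply H2.
    apply (retrel_all_le k); auto. lia.
Qed.

End Retraction.

(** * The solution, its associated group, and the cocycle with values in [Z^X] *)

Section Solution.
Variables (X : Type) (L R : X -> X -> X).
Hypothesis HX : sf_solution X L R.

Lemma GXr_rel_all (H : group) (f : X -> H) : GXr_rel L R H f ->
  forall x y, gmul H (f x) (f y) = gmul H (f (L x y)) (f (R x y)).
Proof.
  intros Hf x y. destruct (classic (rmap L R (x, y) = (x, y))) as [e|n]; auto.
  unfold rmap in e; simpl in e. injection e as e1 e2. now rewrite e1, e2.
Qed.

Lemma trivial_solP : trivial_sol L R <-> forall x y, L x y = y.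
Proof.
  unfold trivial_sol, rmap; simpl. split.
  - intros T x y. specialize (T x y). congruence.
  - intros T x y. rewrite T. f_equal.
    rewrite <- (sf_LR _ _ _ HX y x) at 2. now rewrite T.
Qed.

Lemma retrel_1_all : (forall x y, retrel L 1 x y) <-> trivial_sol L R.
Proof.
  rewrite trivial_solP. simpl. split; intros H x y.
  - rewrite (H x y y). apply (sf_diag _ _ _ HX).
  - intros z. now rewrite !H.
Qed.

(** Level 2 says that the permutation of [L x y] does not depend on [x]; the choice [x = y] and
    square-freeness identify it as that of [y]. *)
Lemma retrel_2_all : (forall x y, retrel L 2 x y) <->
  (forall x y z, L (L x y) z = L y z).
Proof.
  simpl. split.
  - intros H x y z. rewrite (H x y y z). now rewrite (sf_diag _ _ _ HX).
  - intros H x y z w. now rewrite !H.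
Qed.

Lemma nontrivial_inhabited : ~ trivial_sol L R -> inhabited X.
Proof. intros nT. apply NNPP. intros n. apply nT. intros x. exfalso. apply n. now split. Qed.

Lemma mpl_eq_2 :
  mpl_eq L 2 <-> ~ trivial_sol L R /\ forall x y z, L (L x y) z = L y z.
Proof.
  rewrite <- retrel_2_all, <- retrel_1_all. split.
  - intros H. destruct (proj1 (mpl_eq_S _ _ 1 (proj1 (proj1 H))) H). tauto.
  - intros [nT H]. apply mpl_eq_S; [|tauto].
    apply nontrivial_inhabited. now rewrite <- retrel_1_all.
Qed.

(* Affine maps [w |-> tr + w o pv] of the group [Z^X]. *)
Record affine := Affine { tr : X -> Z; pf : X -> X; pv : X -> X;
  pmK : forall x, pv (pf x) = x; piK : forall x, pf (pv x) = x }.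

Lemma affine_ext (a b : affine) : (forall x, tr a x = tr b x) ->
  (forall x, pf a x = pf b x) -> a = b.
Proof.
  destruct a as [v s t st ts], b as [v' s' t' st' ts']. simpl. intros e1 e2.
  assert (e3 : t = t').
  { apply functional_extensionality. intros x.
    now rewrite <- (ts' x) at 1; rewrite <- e2, st. }
  apply functional_extensionality in e1. apply functional_extensionality in e2.
  subst. f_equal; apply proof_irrelevance.
Qed.

Definition affine_group : group.
Proof.
  refine (@Group affine
   (fun a b => @Affine (fun x => (tr a x + tr b (pv a x))%Z)
      (fun x => pf a (pf b x)) (fun x => pv b (pv a x)) _ _)
   (@Affine (fun _ => 0%Z) (fun x => x) (fun x => x) _ _)
   (fun a => @Affine (fun x => (- tr a (pf a x))%Z) (pv a) (pf a) _ _) _ _ _ _ _);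
  intros; try (apply affine_ext; intros; simpl);
  rewrite ?pmK, ?piK, ?pmK, ?piK; try reflexivity; lia.
  Unshelve.
  all: intros; now rewrite ?pmK, ?piK, ?pmK, ?piK.
Defined.

(** The basis vector of [Z^X] at [x]; equality on the arbitrary type [X] is decided classically. *)
Definition delta (x y : X) : Z := if excluded_middle_informative (x = y) then 1%Z else 0%Z.

Lemma delta_eq x : delta x x = 1%Z.
Proof. unfold delta. now destruct excluded_middle_informative. Qed.

Lemma delta_neq x y : x <> y -> delta x y = 0%Z.
Proof. unfold delta. now destruct excluded_middle_informative. Qed.

Lemma delta_iff x y x' y' : (x = y <-> x' = y') -> delta x y = delta x' y'.
Proof. unfold delta. repeat destruct excluded_middle_informative; tauto. Qed.

Variables (G : group) (i : X -> G).
Hypothesis HG : presented i (GXr_rel L R).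
Local Notation "a * b" := (gmul G a b).
Local Notation "1" := (gone G).
Local Notation "a ^-1" := (ginv G a) (at level 1, format "a ^-1").

(** The universal property maps [G] into the subgroup cut out by [P]. Followed by the inclusion,
    this map fixes the generators, so by uniqueness it is the identity of [G]. *)
Lemma presented_ind (P : G -> Prop) : P 1 ->
  (forall a b, P a -> P b -> P (a * b)) -> (forall a, P a -> P a^-1) ->
  (forall x, P (i x)) -> forall g, P g.
Proof.
  intros P1 PM PV Pi.
  set (S := subgroup G P P1 PM PV).
  destruct HG as [Hi HU].
  destruct (HU S (fun x => exist P (i x) (Pi x))) as [[phi [hphi ephi]] _].
  { intros x y n. apply eq_sig_hprop; [intros; apply proof_irrelevance|].
    simpl. now apply Hi. }
  destruct (HU G i Hi) as [_ uniq]. intros g.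
  rewrite (uniq (fun g => g) (fun g => proj1_sig (phi g))).
  - apply (proj2_sig (phi g)).
  - now intros a b.
  - intros a b. now rewrite hphi.
  - reflexivity.
  - intros x. now rewrite ephi.
Qed.

Lemma cocycle_exists : exists (p : G -> X -> Z) (act : G -> X -> X),
  (forall a b x, p (a * b) x = (p a x + p b (act a^-1 x))%Z) /\
  (forall a b x, act (a * b) x = act a (act b x)) /\
  (forall x, act 1 x = x) /\
  (forall x y, p (i x) y = delta x y) /\
  (forall x y, act (i x) y = L x y).
Proof.
  destruct HG as [Hi HU].
  destruct (HU affine_group (fun x => @Affine (delta x) (L x) (fun y => R y x)
     (sf_RL _ _ _ HX x) (sf_LR _ _ _ HX x))) as [[phi [hphi ephi]] _].
  { intros x y _. apply affine_ext; simpl.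
    - intros z.
      (* Both translation parts are [delta x + delta (L x y)], because [L x y] sends [R x y] to [x];
         the terms match crosswise. *)
      enough (delta x z = delta (R x y) (R z (L x y)) /\
              delta y (R z x) = delta (L x y) z) by lia.
      split; apply delta_iff; split; intros e.
      + subst z. rewrite <- (sf_inv _ _ _ HX x y) at 2. now rewrite (sf_RL _ _ _ HX).
      + rewrite <- (sf_inv _ _ _ HX x y), e. apply (sf_LR _ _ _ HX).
      + rewrite e. apply (sf_LR _ _ _ HX).
      + subst z. now rewrite (sf_RL _ _ _ HX).
    - intros z. apply (sf_braid _ _ _ HX). }
  assert (phi1 : phi 1 = gone affine_group) by (now apply hom_one).
  assert (act1 : forall x, pf (phi 1) x = x) by (intros x; now rewrite phi1).
  assert (actM : forall a b x, pf (phi (a * b)) x = pf (phi a) (pf (phi b) x)).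
  { intros a b x. now rewrite hphi. }
  exists (fun g => tr (phi g)), (fun g => pf (phi g)).
  repeat split; auto.
  - intros a b x. rewrite hphi. simpl. do 2 f_equal.
    rewrite <- (piK (phi a) x) at 2.
    now rewrite <- actM, gmulVl, act1.
  - intros x y. now rewrite ephi.
  - intros x y. now rewrite ephi.
Qed.

Lemma presented_inj x y : i x = i y -> x = y.
Proof.
  destruct cocycle_exists as [p [act [_ [_ [_ [pv _]]]]]]. intros e.
  apply NNPP. intros n. pose proof (pv x y) as E.
  rewrite e, pv, delta_eq, (delta_neq _ _ n) in E. discriminate.
Qed.

Lemma nonabelianP : nonabelian G <-> ~ trivial_sol L R.
Proof.
  rewrite trivial_solP. split.
  - intros [a [b n]] T. apply n.
    assert (comm : forall x y, i x * i y = i y * i x).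
    { intros x y. destruct HG as [Hi _]. rewrite (GXr_rel_all G i Hi x y).
      rewrite T. f_equal. f_equal.
      rewrite <- (sf_LR _ _ _ HX y x) at 2. now rewrite T. }
    assert (commV : forall c d : G, c * d = d * c -> c^-1 * d = d * c^-1).
    { intros c d e. apply (gmul_cancel_l c).
      now rewrite gmulVKl, gmulA, e, <- gmulA, gmulVr, gmul1r. }
    revert b n. enough (H : forall b, a * b = b * a) by (intros b n; elim (n (H b))).
    revert a. apply (presented_ind (fun a => forall b, a * b = b * a)).
    + intros b. now rewrite gmul1l, gmul1r.
    + intros a b Ha Hb c. now rewrite <- gmulA, Hb, gmulA, Ha, gmulA.
    + auto.
    + intros x. apply (presented_ind (fun b => i x * b = b * i x)).
      * now rewrite gmul1l, gmul1r.
      * intros a b Ha Hb. now rewrite gmulA, Ha, <- gmulA, Hb, gmulA.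
      * intros a Ha. symmetry. apply commV. now symmetry.
      * apply comm.
  - intros nT. apply NNPP. intros nn. apply nT. intros x y.
    assert (comm : forall a b : G, a * b = b * a).
    { intros a b. apply NNPP. intros n. apply nn. now exists a, b. }
    destruct cocycle_exists as [p [act [pM [actM [act1 [pv ai]]]]]].
    destruct (classic (x = y)) as [<-|nxy]; [apply (sf_diag _ _ _ HX)|].
    apply NNPP. intros n.
    (* At the coordinate [y] the left side is 0 if [x <> y] and [L x] moves [y], whereas the right
       side is at least 1. *)
    pose proof (f_equal (fun g => p g y) (comm (i x) (i y))) as K. simpl in K.
    rewrite !pM, !pv, delta_eq, (delta_neq x y) in K by auto.
    rewrite (delta_neq y (act (i x)^-1 y)) in K.
    + unfold delta in K. destruct excluded_middle_informative; lia.
    + intros e. apply n. rewrite <- ai, e at 1. now rewrite <- actM, gmulVr.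
Qed.

(** * The braiding on the group and its left brace *)

Section BraidedGroup.
Variables (la ra : G -> G -> G).
Hypothesis HsG : symmetric_group la ra.
Hypothesis Hext : forall x y, la (i x) (i y) = i (L x y) /\ ra (i x) (i y) = i (R x y).

Lemma la_ra u v : la (la u v) (ra u v) = u.
Proof. apply HsG. Qed.

Lemma ra_ra u v : ra (la u v) (ra u v) = v.
Proof. apply HsG. Qed.

Lemma la_mul_l a b u : la (a * b) u = la a (la b u).
Proof. apply HsG. Qed.

Lemma la_1l u : la 1 u = u.
Proof. apply HsG. Qed.

Lemma la_1r u : la u 1 = 1.
Proof. apply HsG. Qed.

Lemma ra_1l u : ra 1 u = 1.
Proof. apply HsG. Qed.

Lemma ra_1r u : ra u 1 = u.
Proof. apply HsG. Qed.

Lemma ra_mul_r a u v : ra a (u * v) = ra (ra a u) v.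
Proof. apply HsG. Qed.

Lemma la_mul_r a u v : la a (u * v) = la a u * la (ra a u) v.
Proof. apply HsG. Qed.

Lemma mul_la_ra u v : la u v * ra u v = u * v.
Proof. symmetry. apply HsG. Qed.

Lemma laK a u : la a^-1 (la a u) = u.
Proof. now rewrite <- la_mul_l, gmulVl, la_1l. Qed.

Lemma laVK a u : la a (la a^-1 u) = u.
Proof. now rewrite <- la_mul_l, gmulVr, la_1l. Qed.

Lemma la_inj a u v : la a u = la a v -> u = v.
Proof. intros e. now rewrite <- (laK a u), e, laK. Qed.

Lemma ra_eq a b : ra a b = la (la a b)^-1 a.
Proof. apply (la_inj (la a b)). now rewrite laVK, la_ra. Qed.

Lemma ra_surj a u : exists b, ra b u = a.
Proof. exists (ra a u^-1). now rewrite <- ra_mul_r, gmulVl, ra_1r. Qed.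

Local Notation "a + b" := (badd la a b).
Definition bopp (a : G) : G := la a a^-1.

Lemma badd_opp a : a + bopp a = 1.
Proof. unfold badd, bopp. now rewrite laK, gmulVr. Qed.

Lemma badd_inj a b c : a + b = a + c -> b = c.
Proof. intros e. apply (la_inj a^-1), (gmul_cancel_l a), e. Qed.

Lemma bopp_unique a b : a + b = 1 -> b = bopp a.
Proof. intros e. apply (badd_inj a). now rewrite badd_opp. Qed.

(** After [la_mul_r] it remains to see that [ra g a * a^-1] equals [(la g a)^-1 * g], which is the
    compatibility [la g a * ra g a = g * a]. *)
Lemma la_badd g a b : la g (a + b) = la g a + la g b.
Proof.
  unfold badd. rewrite la_mul_r. f_equal. rewrite <- !la_mul_l. f_equal.
  apply (gmul_cancel_l (la g a)).
  now rewrite gmulA, mul_la_ra, gmulVKl, <- gmulA, gmulVr, gmul1r.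
Qed.

Lemma la_bopp g a : la g (bopp a) = bopp (la g a).
Proof. apply bopp_unique. now rewrite <- la_badd, badd_opp, la_1r. Qed.

(** By [la_mul_r], acting by automorphisms means that [ra a b] acts as [a] does. Involutivity trades
    this for invariance under the left action, since each argument of the braiding is recovered from
    its two values. *)
Lemma la_invariant_iff_acts_as_aut : (forall a b c, la (la b a) c = la a c) <-> acts_as_aut la.
Proof.
  split.
  - intros H a b c. now rewrite la_mul_r, ra_eq, H.
  - intros H a b c.
    assert (E : forall u v w, la (ra u v) w = la u w).
    { intros u v w. apply (gmul_cancel_l (la u v)). now rewrite <- la_mul_r, H. }
    rewrite <- (E (la b a) (ra b a) c), ra_ra. reflexivity.
Qed.

Lemma lri_iff_ra_inv : lri la ra <-> forall a c, ra a c = la c^-1 a.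
Proof.
  split.
  - intros H a c. rewrite <- (laVK c a) at 1. apply H.
  - intros H a b. now rewrite !H, laK, laVK.
Qed.

(** In [ra_eq] the element [la a c] acts as [c], so its inverse acts as [c^-1]. *)
Lemma la_invariant_lri : (forall a b c, la (la b a) c = la a c) -> lri la ra.
Proof.
  intros H. apply lri_iff_ra_inv. intros a c. rewrite ra_eq.
  apply (la_inj c). rewrite <- (H c a) at 1. now rewrite !laVK.
Qed.

Lemma lri_raut : lri la ra -> raut la ra.
Proof. intros H a b c. now rewrite !(proj1 lri_iff_ra_inv H), la_badd. Qed.

(** * Passing between the generators and the group *)

Section Cocycle.
Variables (p : G -> X -> Z) (act : G -> X -> X).
Hypothesis pM : forall a b x, p (a * b) x = (p a x + p b (act a^-1 x))%Z.
Hypothesis actM : forall a b x, act (a * b) x = act a (act b x).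
Hypothesis act1 : forall x, act 1 x = x.
Hypothesis p_gen : forall x y, p (i x) y = delta x y.
Hypothesis act_gen : forall x y, act (i x) y = L x y.

Lemma actK g x : act g^-1 (act g x) = x.
Proof. now rewrite <- actM, gmulVl. Qed.

Lemma actVK g x : act g (act g^-1 x) = x.
Proof. now rewrite <- actM, gmulVr. Qed.

Lemma la_gen g : forall x, la g (i x) = i (act g x).
Proof.
  pattern g; apply presented_ind; clear g.
  - intros x. now rewrite la_1l, act1.
  - intros a b Ha Hb x. now rewrite la_mul_l, Hb, Ha, actM.
  - intros a Ha x. apply (la_inj a). now rewrite laVK, Ha, actVK.
  - intros y x. rewrite act_gen. apply Hext.
Qed.

(** For a generator [c] this is [sf_LR]. By [la_gen] the values stay among the generators, so the
    identity can be composed along a product. *)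
Lemma ra_gen c : forall x, ra (i x) c = la c^-1 (i x).
Proof.
  pattern c; apply presented_ind; clear c.
  - intros x. rewrite ra_1r. apply (la_inj 1). now rewrite laVK, la_1l.
  - intros a b Ha Hb x. rewrite ra_mul_r, Ha, la_gen, Hb, <- la_gen.
    now rewrite <- la_mul_l, <- ginvM.
  - intros a Ha x. rewrite ginvK, la_gen.
    rewrite <- (laK a (i x)) at 1. rewrite la_gen, <- Ha.
    now rewrite <- ra_mul_r, gmulVr, ra_1r.
  - intros y x. apply (la_inj (i y)).
    rewrite laVK, (proj2 (Hext x y)), (proj1 (Hext y _)). f_equal.
    apply (sf_LR _ _ _ HX).
Qed.

(** Serves as an induction principle for identities that are additive in the brace, next to the
    multiplicative [presented_ind]. *)
Inductive additive_span : G -> Prop :=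
| span_one : additive_span 1
| span_gen x : additive_span (i x)
| span_add a b : additive_span a -> additive_span b -> additive_span (a + b)
| span_opp a : additive_span a -> additive_span (bopp a).

Lemma additive_span_la g a : additive_span a -> additive_span (la g a).
Proof.
  induction 1.
  - rewrite la_1r. constructor.
  - rewrite la_gen. constructor.
  - rewrite la_badd. now constructor.
  - rewrite la_bopp. now constructor.
Qed.

(** Multiplication is expressed by the brace: [a * b = a + la a b] and [a^-1 = la a^-1 (bopp a)],
    and the span is stable under [la]. *)
Lemma additive_span_all g : additive_span g.
Proof.
  pattern g; apply presented_ind; clear g.
  - constructor.
  - intros a b Ha Hb. rewrite <- (laK a b). apply span_add; auto using additive_span_la.
  - intros a Ha. rewrite <- (laK a a^-1).
    apply additive_span_la. now apply (span_opp a).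
  - constructor.
Qed.

Lemma la_ext g h : (forall x, act g x = act h x) -> forall u, la g u = la h u.
Proof.
  intros e u. induction (additive_span_all u).
  - now rewrite !la_1r.
  - now rewrite !la_gen, e.
  - rewrite !la_badd. congruence.
  - rewrite !la_bopp. congruence.
Qed.

Lemma raut_lri : raut la ra -> lri la ra.
Proof.
  intros H. apply lri_iff_ra_inv. intros a c. induction (additive_span_all a).
  - now rewrite ra_1l, la_1r.
  - apply ra_gen.
  - rewrite H, la_badd. congruence.
  - rewrite la_bopp, <- IHa0. apply bopp_unique.
    now rewrite <- H, badd_opp, ra_1l.
Qed.

Lemma L_invariant_la_invariant : (forall x y z, L (L x y) z = L y z) ->
  forall a b c, la (la b a) c = la a c.
Proof.
  intros Hinv a b. apply la_ext. revert b.
  (* First [a] is a generator and [b] is built up; then [a] is built up for all [b] at once. *)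
  assert (gen : forall b x z, act (i (act b x)) z = act (i x) z).
  { intros b. pattern b; apply presented_ind; clear b.
    - intros x z. now rewrite act1.
    - intros a' b Ha Hb x z. now rewrite actM, Ha, Hb.
    - intros b Hb x z. rewrite <- Hb. now rewrite actVK.
    - intros y x z. rewrite !act_gen. apply Hinv. }
  revert a. apply (presented_ind (fun a => forall b x, act (la b a) x = act a x)).
  - intros b x. now rewrite la_1r.
  - intros u v Hu Hv b x. now rewrite la_mul_r, !actM, Hu, Hv.
  (* With [b] written as [ra k u], expanding [la k (u * u^-1) = 1] shows that [la b u^-1] is the
     inverse of [la k u], to which the hypothesis on [u] applies. *)
  - intros u Hu b x. destruct (ra_surj b u) as [k <-].
    assert (e : la k u * la (ra k u) u^-1 = 1) by now rewrite <- la_mul_r, gmulVr, la_1r.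
    rewrite (ginv_unique _ _ e).
    rewrite <- (actVK u x) at 1. rewrite <- (Hu k). apply actK.
  - intros y b x. now rewrite la_gen, gen.
Qed.

Lemma la_invariant_L_invariant : (forall a b c, la (la b a) c = la a c) ->
  forall x y z, L (L x y) z = L y z.
Proof.
  intros H x y z. apply presented_inj.
  rewrite <- (proj1 (Hext (L x y) z)), <- (proj1 (Hext x y)), H. apply Hext.
Qed.

Lemma p_la_gen g x y : p (la g (i x)) y = p (i x) (act g^-1 y).
Proof.
  rewrite la_gen, !p_gen. apply delta_iff. split; intros e.
  - now rewrite <- e, actK.
  - now rewrite e, actVK.
Qed.

(** Equivariance of [p] survives products because [la g u * ra g u = g * u]; together with
    [p_la_gen] this covers all words in the generators. *)
Lemma p_la_mul u v : (forall g y, p (la g u) y = p u (act g^-1 y)) ->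
  (forall g y, p (la g v) y = p v (act g^-1 y)) ->
  forall g y, p (la g (u * v)) y = p (u * v) (act g^-1 y).
Proof.
  intros Hu Hv g y. rewrite la_mul_r, !pM, Hu, Hv. f_equal. f_equal.
  now rewrite <- !actM, <- !ginvM, mul_la_ra.
Qed.

(** Both sides compute [ra a b], one by lri and the other by involutivity. *)
Lemma lri_inv_eq : lri la ra -> forall a b, la b^-1 a = la (la a b)^-1 a.
Proof. intros H a b. now rewrite <- (proj1 lri_iff_ra_inv H), ra_eq. Qed.

(* In [Z^X] the element [x x y] is [2 x + (some generator)], so an equality
   between its images under two elements of [G] already holds for [x]. *)
Lemma lri_L_invariant : lri la ra -> forall x y z, L (L x y) z = L y z.
Proof.
  intros H. pose proof (lri_inv_eq H) as E.
  assert (E1 : forall x b, la (la (i x) b)^-1 (i x) = la b^-1 (i x)) by (intros; symmetry; apply E).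
  assert (E2 : forall x y b,
    la (la (i x * (i x * i y)) b)^-1 (i x) = la b^-1 (i x)).
  { intros x y b. rewrite !la_gen. f_equal. apply NNPP. intros n.
    set (a := i x * (i x * i y)). fold a in n.
    assert (Pa : forall g z, p (la g a) z = p a (act g^-1 z)).
    { repeat apply p_la_mul; auto using p_la_gen. }
    assert (Pv : forall z, p a z = (2 * delta x z + delta (L x (L x y)) z)%Z).
    { intros z. unfold a. rewrite !pM, !p_gen.
      rewrite (delta_iff x (act (i x)^-1 z) x z), (delta_iff y _ (L x (L x y)) z).
      - lia.
      - rewrite <- !act_gen. split; intros e.
        + now rewrite e, !actVK.
        + now rewrite <- e, !actK.
      - split; intros e.
        + rewrite <- (sf_diag _ _ _ HX x), <- act_gen. rewrite e at 2. apply actVK.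
        + subst z. rewrite <- (sf_diag _ _ _ HX x) at 3. now rewrite <- act_gen, actK. }
    set (s := b^-1) in *. set (t := (la a b)^-1) in *.
    assert (Es : la s a = la t a) by apply E.
    (* At the coordinate [act s x] the left side is at least 2. If [act s x] and [act t x] differ,
       [x] contributes nothing on the right, and the remaining generator contributes at most 1. *)
    pose proof (f_equal (fun g => p g (act s x)) Es) as K. simpl in K.
    rewrite !Pa, actK, !Pv, delta_eq in K.
    rewrite (delta_neq x (act t^-1 (act s x))) in K.
    - unfold delta in K. repeat destruct excluded_middle_informative; lia.
    - intros e. apply n. rewrite e at 1. now rewrite actVK. }
  (* Two uses of [E1] strip the leading factors [i x] in [E2], leaving an arbitrary generator
     [y]. *)
  assert (E3 : forall x y b, la (la (i y) b)^-1 (i x) = la b^-1 (i x)).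
  { intros x y b. now rewrite <- (E2 x y b), !la_mul_l, !E1. }
  intros y z x. apply presented_inj.
  rewrite <- (proj1 (Hext (L y z) x)), <- (proj1 (Hext y z)), <- (proj1 (Hext z x)).
  apply (la_inj (i z)^-1). rewrite laK, la_gen, <- (E3 _ y), <- la_gen. apply laK.
Qed.
End Cocycle.

Lemma L_invariant_iff_la_invariant : (forall x y z, L (L x y) z = L y z) <->
  (forall a b c, la (la b a) c = la a c).
Proof.
  destruct cocycle_exists as [p [act [pM [actM [act1 [p_gen act_gen]]]]]]. split.
  - now apply (L_invariant_la_invariant act).
  - apply la_invariant_L_invariant.
Qed.

Lemma L_invariant_iff_lri : (forall x y z, L (L x y) z = L y z) <-> lri la ra.
Proof.
  destruct cocycle_exists as [p [act [pM [actM [act1 [p_gen act_gen]]]]]]. split.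
  - intros H. now apply la_invariant_lri, L_invariant_iff_la_invariant.
  - now apply (lri_L_invariant p act).
Qed.

Lemma raut_iff_lri : raut la ra <-> lri la ra.
Proof.
  destruct cocycle_exists as [p [act [pM [actM [act1 [p_gen act_gen]]]]]]. split.
  - now apply (raut_lri act).
  - apply lri_raut.
Qed.

(** Comparison with the neutral element, which acts trivially, takes the place that square-freeness
    has on [X]. *)
Lemma mpl_eq_2_group_iff_la_invariant : ~ trivial_sol L R ->
  (mpl_eq la 2 <-> forall a b c, la (la b a) c = la a c).
Proof.
  intros nT. rewrite (mpl_eq_S _ _ 1 (inhabits 1)). simpl. split.
  - intros [H _] a b c. now rewrite (H b 1 a c), la_1l.
  - intros H. split; [intros a b c d; now rewrite !H|].
    intros T. apply nT. rewrite trivial_solP. intros x y. apply presented_inj.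
    now rewrite <- (proj1 (Hext x y)), (T (i x) 1), la_1l.
Qed.

Lemma mpl_eq_2_iff_nonabelian_lri : mpl_eq L 2 <-> nonabelian G /\ lri la ra.
Proof. now rewrite mpl_eq_2, nonabelianP, L_invariant_iff_lri. Qed.
End BraidedGroup.
End Solution.

(** * Congruences, quotient solutions and derived groups *)

Record congruence (X : Type) (L R : X -> X -> X) (E : X -> X -> Prop) : Prop := {
  cg_refl : forall x, E x x;
  cg_sym : forall x y, E x y -> E y x;
  cg_trans : forall x y z, E x y -> E y z -> E x z;
  cg_L : forall x x' y y', E x x' -> E y y' -> E (L x y) (L x' y');
  cg_R : forall x x' y y', E x x' -> E y y' -> E (R x y) (R x' y') }.

Section Quotient.
Variables (X : Type) (L R : X -> X -> X).
Hypothesis HX : sf_solution X L R.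

(** The braid relation factors [L x] after [L y] as [L (L x y)] after [L (R x y)]. Solving for
    either factor gives compatibility with [L] and with [R]. *)
Lemma congruence_retract (E : X -> X -> Prop) : congruence X L R E ->
  congruence X L R (fun x y => forall z, E (L x z) (L y z)).
Proof.
  intros [re sy tr cL cR].
  assert (sub : forall a b, E a b -> forall z, E (L a z) (L b z)) by auto.
  (* [R x y] is the preimage of [x] under [L y], so it depends on [y] only through its permutation
     modulo [E]. *)
  assert (Rr : forall x y y', (forall z, E (L y z) (L y' z)) -> E (R x y) (R x y')).
  { intros x y y' H. apply sy.
    rewrite <- (sf_RL _ _ _ HX y' (R x y)). apply cR; auto.
    rewrite <- (sf_LR _ _ _ HX y x) at 1. apply H. }
  split.
  - auto.
  - auto.
  - intros x y z Hxy Hyz w. now apply (tr _ (L y w)).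
  - intros x x' y y' Hx Hy w. apply (tr _ (L (L x y') w)); auto.
    rewrite <- (sf_LR _ _ _ HX (R x y) w). set (z := R w (R x y)).
    rewrite <- (sf_braid _ _ _ HX). apply (tr _ (L x (L y' z))); auto.
    rewrite (sf_braid _ _ _ HX x y'). apply cL; auto.
  - intros x x' y y' Hx Hy w. apply (tr _ (L (R x' y) w)).
    + rewrite <- (sf_RL _ _ _ HX (L x y) (L (R x y) w)).
      rewrite <- (sf_RL _ _ _ HX (L x' y) (L (R x' y) w)).
      rewrite <- !(sf_braid _ _ _ HX). auto.
    + auto.
Qed.

Lemma congruence_retrel j : congruence X L R (retrel L j).
Proof.
  induction j as [|j IH]; simpl.
  - split; intros; congruence.
  - now apply congruence_retract.
Qed.

Variable E : X -> X -> Prop.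
Hypothesis HE : congruence X L R E.

(** Classes are predicates, so that related points become equal in the sense of Leibniz, as
    [sf_solution] and [presented] require. *)
Definition quot : Type := {P : X -> Prop | exists x, P = E x}.
Definition cls (x : X) : quot := exist _ (E x) (ex_intro _ x eq_refl).
Definition rep (y : quot) : X :=
  proj1_sig (constructive_indefinite_description _ (proj2_sig y)).

Lemma cls_rep y : cls (rep y) = y.
Proof.
  apply eq_sig_hprop; [intros; apply proof_irrelevance|]. simpl. unfold rep.
  symmetry. apply (proj2_sig (constructive_indefinite_description _ (proj2_sig y))).
Qed.

Lemma cls_surj y : exists x, cls x = y.
Proof. exists (rep y). apply cls_rep. Qed.

Lemma cls_eq x y : cls x = cls y <-> E x y.
Proof.
  destruct HE as [re sy tr cL cR]. split.
  - intros e. injection e as e. rewrite e. apply re.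
  - intros e. apply eq_sig_hprop; [intros; apply proof_irrelevance|]. simpl.
    apply functional_extensionality. intros z.
    apply propositional_extensionality. split; eauto.
Qed.

Lemma rep_cls x : E (rep (cls x)) x.
Proof. apply cls_eq, cls_rep. Qed.

Definition quotL (y z : quot) : quot := cls (L (rep y) (rep z)).
Definition quotR (y z : quot) : quot := cls (R (rep y) (rep z)).

Lemma quotLE x y : quotL (cls x) (cls y) = cls (L x y).
Proof. apply cls_eq, (cg_L _ _ _ _ HE); apply rep_cls. Qed.

Lemma quotRE x y : quotR (cls x) (cls y) = cls (R x y).
Proof. apply cls_eq, (cg_R _ _ _ _ HE); apply rep_cls. Qed.

Lemma sf_solution_quot : sf_solution quot quotL quotR.
Proof.
  split.
  - intros y z. destruct (cls_surj y) as [a <-], (cls_surj z) as [b <-].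
    now rewrite quotRE, quotLE, (sf_LR _ _ _ HX).
  - intros y z. destruct (cls_surj y) as [a <-], (cls_surj z) as [b <-].
    now rewrite quotLE, quotRE, (sf_RL _ _ _ HX).
  - intros y. destruct (cls_surj y) as [a <-].
    now rewrite quotLE, (sf_diag _ _ _ HX).
  - intros y z. destruct (cls_surj y) as [a <-], (cls_surj z) as [b <-].
    now rewrite quotLE, quotRE, quotLE, (sf_inv _ _ _ HX).
  - intros y z w.
    destruct (cls_surj y) as [a <-], (cls_surj z) as [b <-], (cls_surj w) as [c <-].
    now rewrite quotRE, !quotLE, (sf_braid _ _ _ HX).
Qed.

(** Maps on [X] constant on classes correspond to maps on [quot], and so do the relations imposed on
    them. For [E = retrel L j] the hypothesis unfolds to a presentation by [Gj_rel L R j]. *)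
Lemma presented_quot (G : group) (i : X -> G) :
  presented i (fun H f => (forall x y, E x y -> f x = f y) /\
    (forall x y, ~ (E (L x y) x /\ E (R x y) y) ->
       gmul H (f x) (f y) = gmul H (f (L x y)) (f (R x y)))) ->
  presented (fun y => i (rep y)) (GXr_rel quotL quotR).
Proof.
  intros [[Hc Hi] HU]. split.
  - intros y z n. unfold quotL, quotR. rewrite !(Hc _ _ (rep_cls _)). apply Hi. intros [e1 e2]. apply n.
    unfold rmap; simpl. unfold quotL, quotR.
    now rewrite (proj2 (cls_eq _ _) e1), (proj2 (cls_eq _ _) e2), !cls_rep.
  - intros H f Hf. destruct (HU H (fun x => f (cls x))) as [[phi [hphi ephi]] uniq].
    { split.
      - intros x y e. f_equal. now apply cls_eq.
      - intros x y n. rewrite <- quotLE, <- quotRE. apply Hf. intros e. apply n.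
        unfold rmap in e; simpl in e. rewrite quotLE, quotRE in e.
        injection e as e1 e2. split; apply cls_eq.
        + apply eq_sig_hprop; [intros; apply proof_irrelevance|]. exact e1.
        + apply eq_sig_hprop; [intros; apply proof_irrelevance|]. exact e2. }
    split.
    + exists phi. split; auto. intros y. now rewrite ephi, cls_rep.
    + intros phi1 phi2 h1 h2 e1 e2. apply uniq; auto; intros x.
      * rewrite <- e1. f_equal. symmetry. apply Hc, rep_cls.
      * rewrite <- e2. f_equal. symmetry. apply Hc, rep_cls.
Qed.
End Quotient.

Lemma retrel_quot (X : Type) (L R : X -> X -> X) (HX : sf_solution X L R) j k x y :
  retrel (quotL X L (retrel L j)) k (cls X (retrel L j) x) (cls X (retrel L j) y)
  <-> retrel L (k + j) x y.
Proof.
  pose proof (congruence_retrel X L R HX j) as HE. revert x y.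
  induction k as [|k IH]; simpl; intros x y.
  - now apply (cls_eq X L R).
  - split; intros H z.
    + rewrite <- IH, <- !(quotLE X L R _ HE). apply H.
    + rewrite <- (cls_rep X _ z), !(quotLE X L R _ HE). apply IH, H.
Qed.

(** The successor matters: level 0 of the quotient would only bound the level of [X] by [j], without
    minimality. *)
Lemma mpl_eq_quot (X : Type) (L R : X -> X -> X) (HX : sf_solution X L R) j m :
  inhabited X ->
  (mpl_eq (quotL X L (retrel L j)) (S m) <-> mpl_eq L (S m + j)).
Proof.
  intros HI. assert (all : forall k,
    (forall x y, retrel (quotL X L (retrel L j)) k x y) <->
    (forall x y, retrel L (k + j) x y)).
  { intros k. split; intros H x y.
    - now apply (retrel_quot X L R HX).
    - rewrite <- (cls_rep X _ x), <- (cls_rep X _ y).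
      now apply (retrel_quot X L R HX). }
  change (S m + j) with (S (m + j)).
  rewrite (mpl_eq_S X L _ HI), mpl_eq_S, !all; [reflexivity|].
  destruct HI as [x]. exact (inhabits (cls X _ x)).
Qed.

Theorem mainTheorem16 (X : Type) (L R : X -> X -> X)
  (Hsym : symmetric_set L R) (Hsf : square_free L R) (Hnt : ~ trivial_sol L R)
  (G : group) (i : X -> G) (HG : presented i (GXr_rel L R))
  (HS : S_embeds L R i)
  (la ra : G -> G -> G) (HsG : symmetric_group la ra)
  (Hext : forall x y, la (i x) (i y) = i (L x y) /\ ra (i x) (i y) = i (R x y)) :
  ((mpl_eq L 2 <-> mpl_eq la 2) /\
   (mpl_eq L 2 <-> acts_as_aut la) /\
   (mpl_eq L 2 <-> (forall a b c, la (la b a) c = la a c)) /\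
   (mpl_eq L 2 <-> lri la ra) /\
   (mpl_eq L 2 <-> raut la ra)) /\
  (forall m : nat, 2 <= m ->
   forall (Gm : group) (im : X -> Gm) (lam ram : Gm -> Gm -> Gm),
     presented im (Gj_rel L R (m - 2)) ->
     symmetric_group lam ram ->
     (forall x y, lam (im x) (im y) = im (L x y) /\ ram (im x) (im y) = im (R x y)) ->
     (mpl_eq L m <-> nonabelian Gm /\ lri lam ram)).
Proof.
  pose proof (sf_solution_of_symmetric X L R Hsym Hsf) as HX. split.
  - pose proof (mpl_eq_2 X L R HX) as E.
    pose proof (L_invariant_iff_la_invariant X L R HX G i HG la ra HsG Hext) as E1.
    pose proof (L_invariant_iff_lri X L R HX G i HG la ra HsG Hext) as E2.
    pose proof (raut_iff_lri X L R HX G i HG la ra HsG Hext) as E3.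
    pose proof (mpl_eq_2_group_iff_la_invariant X L R HX G i HG la ra HsG Hext Hnt) as E4.
    pose proof (la_invariant_iff_acts_as_aut G la ra HsG) as E5.
    tauto.
  - intros m Hm Gm im lam ram HP HsGm Hextm.
    set (j := m - 2) in *. replace m with (2 + j) by (unfold j; lia).
    pose proof (congruence_retrel X L R HX j) as HE.
    rewrite <- (mpl_eq_quot X L R HX j 1 (nontrivial_inhabited X L R Hnt)).
    apply (mpl_eq_2_iff_nonabelian_lri _ _ _ (sf_solution_quot X L R HX _ HE) Gm
      (fun y => im (rep X _ y)) (presented_quot X L R _ HE Gm im HP) lam ram HsGm).
    (* [im] is constant on classes, so the choice of representatives does not affect the braiding of
       generators. *)
    intros y z. destruct HP as [[Hc _] _].
    unfold quotL, quotR. rewrite !(Hc _ _ (rep_cls X L R _ HE _)). apply Hextm.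
Qed.
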